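(* Let $1\le p\le n$. There is an EREW PRAM algorithm that performs parallel prefix on an array of $n$ elements in $O(n)$ work and $O(n/p+\log p)$ span given $O(p)$ processors, each having $O(1)$ words of private memory. The algorithm is in-place: it allocates no shared memory aside from the input array.
   Context: PRAM model: synchronous processors with a shared memory, each processor also having its own private memory, measured in words. In the EREW (Exclusive-Read, Exclusive-Write) PRAM, no two processors may read or write the same shared memory location concurrently. Work is the total number of operations performed; span is the maximum number of operations performed by a single processor (here, when the algorithm runs on the stated number of processors). Parallel prefix problem: given an array $A[0..n-1]$ in shared memory whose entries (one word each) can be combined by an associative operation $\oplus$ with identity (e.g. addition with identity $0$) computable in constant time, replace each $A[i]$ by its prefix value $A[0]\oplus\cdots\oplus A[i-1]$ (the identity for $i=0$), using the original entries. *)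

(* Defs.v *)
From mathcomp Require Import all_boot.

Set Implicit Arguments.
Unset Strict Implicit.
Unset Printing Implicit Defensive.

(* A word holds either a number (always kept below 2 ^ w, where w is the word
   size in bits) or one element of the carrier T of the prefix operation.
   Elements are opaque: programs can only move and combine them.  Using a word
   of the wrong kind is an error, so the tag cannot be tested. *)
Inductive word (T : Type) := NumW of nat | EltW of T.
Arguments NumW {T}.
Arguments EltW {T}.

Definition as_num T (v : word T) : option nat :=
  if v is NumW a then Some a else None.

Definition as_elt T (v : word T) : option T :=
  if v is EltW x then Some x else None.

Inductive arith := AddW | SubW | MulW | DivW.

(* Arithmetic modulo 2 ^ w, except that subtraction truncates at 0; division by
   0 yields 0. *)
Definition eval_arith (w : nat) (o : arith) (a b : nat) : nat :=
  match o with
  | AddW => (a + b) %% 2 ^ w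
  | SubW => a - b
  | MulW => (a * b) %% 2 ^ w
  | DivW => a %/ b
  end.

(* Instructions of a processor whose private memory has k words.  Private
   memory is addressed directly only; shared memory is addressed through a
   private word holding the address. *)
Inductive instr (k : nat) :=
  | Const of 'I_k & nat
  | Pid of 'I_k                        (* own index, in 0 .. P-1 *)
  | Nproc of 'I_k                      (* number P of processors *)
  | Size of 'I_k                       (* size n of the shared memory *)
  | Ident of 'I_k                      (* identity of the prefix operation *)
  | Move of 'I_k & 'I_k                (* destination, source *)
  | Arith of arith & 'I_k & 'I_k & 'I_k
  | Comb of 'I_k & 'I_k & 'I_k         (* r := s op t *)
  | Read of 'I_k & 'I_k                (* r := shared[s] *)
  | Write of 'I_k & 'I_k               (* shared[r] := s *)
  | Jump of nat
  | JumpLt of 'I_k & 'I_k & nat.       (* if r < s then goto l *)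

(* One program is run by all the processors. *)
Definition program (k : nat) := seq (instr k).

(* nops counts the instructions executed so far.  It cannot be accessed by
   programs and only serves to define work and span. *)
Record pstate (k : nat) (T : Type) :=
  PState { pc : nat; reg : 'I_k -> word T; nops : nat }.

(* The shared memory has exactly n words. *)
Record config (n P k : nat) (T : Type) :=
  Config { shared : 'I_n -> word T; proc : 'I_P -> pstate k T }.

(* A processor halts by leaving the program. *)
Definition halted k T (prog : program k) (s : pstate k T) : bool :=
  size prog <= pc s.

(* The shared memory access made by one processor in one step. *)
Inductive access (n : nat) (T : Type) :=
  | NoAccess
  | Reads of 'I_n
  | Writes of 'I_n & word T.
Arguments NoAccess {n T}.
Arguments Reads {n T}.
Arguments Writes {n T}.

Definition location n T (q : access n T) : option 'I_n :=
  match q with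
  | NoAccess => None
  | Reads x => Some x
  | Writes x _ => Some x
  end.

Definition written n T (q : access n T) (x : 'I_n) : option (word T) :=
  if q is Writes y v then (if y == x then Some v else None) else None.

Definition setr k T (s : pstate k T) (r : 'I_k) (v : word T) : pstate k T :=
  PState (pc s).+1 (fun r' => if r' == r then v else reg s r') (nops s).+1.

Definition goto k T (s : pstate k T) (l : nat) : pstate k T :=
  PState l (reg s) (nops s).+1.

(* One instruction of processor i of P; None is a run-time error (word of the
   wrong kind, or address outside the shared memory). *)
Definition exec (w n P k : nat) (T : Type) (e : T) (op : T -> T -> T)
    (m : 'I_n -> word T) (i : 'I_P) (s : pstate k T) (ins : instr k) :
    option (pstate k T * access n T) :=
  let num r := as_num (reg s r) in
  let elt r := as_elt (reg s r) in
  let addr r : option 'I_n := obind insub (num r) in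
  let set r v := Some (setr s r v, NoAccess) in
  match ins with
  | Const r a => set r (NumW (a %% 2 ^ w))
  | Pid r => set r (NumW (i %% 2 ^ w))
  | Nproc r => set r (NumW (P %% 2 ^ w))
  | Size r => set r (NumW (n %% 2 ^ w))
  | Ident r => set r (EltW e)
  | Move r u => set r (reg s u)
  | Arith o r u v =>
      match num u, num v with
      | Some a, Some b => set r (NumW (eval_arith w o a b))
      | _, _ => None
      end
  | Comb r u v =>
      match elt u, elt v with
      | Some x, Some y => set r (EltW (op x y))
      | _, _ => None
      end
  | Read r u => omap (fun x => (setr s r (m x), Reads x)) (addr u)
  | Write u r =>
      omap (fun x => (goto s (pc s).+1, Writes x (reg s r))) (addr u)
  | Jump l => Some (goto s l, NoAccess)
  | JumpLt u v l =>
      match num u, num v with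
      | Some a, Some b =>
          Some (goto s (if a < b then l else (pc s).+1), NoAccess)
      | _, _ => None
      end
  end.

Definition local_step (w n P k : nat) (T : Type) (e : T) (op : T -> T -> T)
    (prog : program k) (m : 'I_n -> word T) (i : 'I_P) (s : pstate k T) :
    option (pstate k T * access n T) :=
  if onth prog (pc s) is Some ins then exec w e op m i s ins
  else Some (s, NoAccess).

(* EREW: distinct processors access distinct shared locations. *)
Definition exclusive n P T (q : 'I_P -> access n T) : bool :=
  [forall i, forall j, (i != j) ==>
     ((location (q i) == None) || (location (q i) != location (q j)))].

(* One synchronous step: every processor that has not halted executes one
   instruction.  The result is None if some processor errs or if the accesses
   are not exclusive.  Exclusiveness makes the choice of a writer of x below
   unambiguous. *)
Definition step (w n P k : nat) (T : Type) (e : T) (op : T -> T -> T)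
    (prog : program k) (c : config n P k T) : option (config n P k T) :=
  let res i := local_step w e op prog (shared c) i (proc c i) in
  let out i := odflt (proc c i, NoAccess) (res i) in
  if [forall i, isSome (res i)] && exclusive (fun i => (out i).2) then
    Some (Config
      (fun x =>
         odflt (shared c x)
           (obind (fun i => written (out i).2 x)
              [pick i | isSome (written (out i).2 x)]))
      (fun i => (out i).1))
  else None.

Definition run (w n P k : nat) (T : Type) (e : T) (op : T -> T -> T)
    (prog : program k) (t : nat) (c : config n P k T) :
    option (config n P k T) :=
  iter t (obind (step w e op prog)) (Some c).

Definition initial (n P k : nat) (T : Type) (A : 'I_n -> T) :
    config n P k T :=
  Config (fun x => EltW (A x)) (fun=> PState 0 (fun=> NumW 0) 0).

Definition all_halted n P k T (prog : program k) (c : config n P k T) : bool :=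
  [forall i, halted prog (proc c i)].

Definition work n P k T (c : config n P k T) : nat :=
  \sum_(i < P) nops (proc c i).

Definition span n P k T (c : config n P k T) : nat :=
  \max_(i < P) nops (proc c i).

(* Monoid.law bundles associativity of op and neutrality of e; op need not be
   commutative, and the big operator combines A 0, ..., A i.-1 in this order. *)
Definition prefix_value (T : Type) (e : T) (op : Monoid.law e) (n : nat)
    (A : 'I_n -> T) (i : 'I_n) : T :=
  \big[op/e]_(j < n | j < i) A j.

(* Main.v *)
Require Import Defs.
From mathcomp Require Import all_boot.
From mathcomp Require Import zify.
From Stdlib Require Import FunctionalExtensionality.

(* With p processors the array is cut into blocks of size s, about
   n / p + log p; only the processors i with i * s < n take part, so that the
   number of participants times s is O(n).  Each participant combines the block
   before its own, keeps the first entry of its own block in a register and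
   uses the freed cell as a mailbox.  Pointer jumping over the mailboxes takes
   O(log p) rounds and leaves with each participant the prefix of its block,
   from which it fills the block sequentially.

   A processor that is not needed must find this out in O(1) amortized time,
   although it cannot afford to compute log p.  All processors double y and
   square 2 ^ y until 2 ^ y > p, and processor i halts as soon as i * y >= n.
   At most n / y + 1 processors survive a given y, and these numbers sum to
   O(n) over the powers y of 2. *)

Set Implicit Arguments.
Unset Strict Implicit.
Unset Printing Implicit Defensive.

(** * Separate reasoning about processors with disjoint footprints *)

Section ParallelComposition.

Variables (w n P k : nat) (T : Type) (e : T) (op : T -> T -> T).
Variable prog : program k.

Implicit Types (m : 'I_n -> word T) (s : pstate k T) (c : config n P k T).
Implicit Types (i : 'I_P) (D : pred 'I_n).

Definition update m (q : access n T) : 'I_n -> word T :=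
  fun x => odflt (m x) (written q x).

(* Processor i, running alone for t steps, accesses only cells of D and ends in
   a state satisfying Q. *)
Fixpoint wp t D i m s (Q : ('I_n -> word T) -> pstate k T -> Prop) : Prop :=
  if t is t'.+1 then
    exists s' q,
      [/\ local_step w e op prog m i s = Some (s', q),
          forall x, location q = Some x -> D x
        & wp t' D i (update m q) s' Q]
  else Q m s.

Lemma location_written (q : access n T) x : isSome (written q x) -> location q = Some x.
Proof. by case: q => //= y v; case: eqP => // ->. Qed.

(** A step looks at the memory only in the cell that it reads. *)
Lemma local_step_agree m1 m2 i s s' q :
    local_step w e op prog m1 i s = Some (s', q) ->
    (forall x, location q = Some x -> m1 x = m2 x) ->
  local_step w e op prog m2 i s = Some (s', q).
Proof.
rewrite /local_step; case: (onth _ _) => // -[] //= r u.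
by case: obind => //= x [<- <-] /(_ x erefl) ->.
Qed.

(** Disjoint footprints make the accesses exclusive. They also leave [i] as the only possible writer
    in [D i], so the merged memory agrees there with the private copy. *)
Lemma step_par c (ms : 'I_P -> 'I_n -> word T) (out : 'I_P -> pstate k T * access n T)
    (D : 'I_P -> pred 'I_n) :
    (forall i j x, D i x -> D j x -> i = j) ->
    (forall i x, D i x -> ms i x = shared c x) ->
    (forall i, local_step w e op prog (ms i) i (proc c i) = Some (out i)) ->
    (forall i x, location (out i).2 = Some x -> D i x) ->
  exists c', [/\ step w e op prog c = Some c',
    forall i, proc c' i = (out i).1,
    forall i x, D i x -> shared c' x = update (ms i) (out i).2 x
    & forall x, (forall i, ~~ D i x) -> shared c' x = shared c x].
Proof.
move=> disj agree stepE locD.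
have resE i : local_step w e op prog (shared c) i (proc c i) = Some (out i).
  case E: (out i) (stepE i) (locD i) => [s' q] stepi loci.
  by apply: local_step_agree stepi _ => x /loci; exact: agree.
rewrite /step.
have -> : [forall i, isSome (local_step w e op prog (shared c) i (proc c i))].
  by apply/forallP => i; rewrite resE.
have -> : exclusive (fun i => (odflt (proc c i, NoAccess)
    (local_step w e op prog (shared c) i (proc c i))).2).
  apply/forallP => i; apply/forallP => j; apply/implyP => neq_ij; rewrite !resE /=.
  case Ei: (location (out i).2) => [x|] //=; apply/eqP => Ej.
  by rewrite (disj i j x) ?eqxx // in neq_ij; apply: locD; rewrite -?Ej.
eexists; split; [by [] | by move=> i /=; rewrite resE | |] => /=.
- move=> i x Dix; case: pickP => [j /= | no_write] /=.
    rewrite resE /= => wj; have Ej := location_written wj.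
    by rewrite (disj i j x) ?(locD j) // /update; case: written wj.
  by move: (no_write i); rewrite resE /= /update -(agree i) //; case: written.
- move=> x Dx; case: pickP => [j | _] //=; rewrite resE /= => /location_written.
  by move/locD; rewrite (negbTE (Dx j)).
Qed.

(* Processors that own pairwise disjoint sets of cells cannot interfere, so
   each may be run on its own copy ms i of the memory. *)
Lemma run_par t c (ms : 'I_P -> 'I_n -> word T) (D : 'I_P -> pred 'I_n)
    (Q : 'I_P -> ('I_n -> word T) -> pstate k T -> Prop) :
    (forall i j x, D i x -> D j x -> i = j) ->
    (forall i x, D i x -> ms i x = shared c x) ->
    (forall i, wp t (D i) i (ms i) (proc c i) (Q i)) ->
  exists c', [/\ run w e op prog t c = Some c',
    forall x, (forall i, ~~ D i x) -> shared c' x = shared c x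
    & forall i, exists m, Q i m (proc c' i) /\ forall x, D i x -> shared c' x = m x].
Proof.
move=> disj; elim: t c ms => [|t IHt] c ms agree wpc.
  by exists c; split=> // i; exists (ms i); split=> [|x Dix]; [exact: wpc | rewrite agree].
pose out i := odflt (proc c i, NoAccess) (local_step w e op prog (ms i) i (proc c i)).
have [||c' [stepE procE memD memN]] := @step_par c ms out D disj agree.
- by move=> i; have [s' [q [E _ _]]] := wpc i; rewrite /out E.
- by move=> i x; have [s' [q [E locD _]]] := wpc i; rewrite /out E /=; exact: locD.
have [||c'' [runE memN' Qc'']] := IHt c' (fun i => update (ms i) (out i).2).
- by move=> i x Dix; rewrite (memD i).
- by move=> i; have [s' [q [E _ wpt]]] := wpc i; rewrite procE /out E.
exists c''; split=> //; first by rewrite /run iterSr /= stepE.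
by move=> x Dx; rewrite memN' ?memN.
Qed.

Lemma run_add t1 t2 c c1 c2 :
    run w e op prog t1 c = Some c1 -> run w e op prog t2 c1 = Some c2 ->
  run w e op prog (t1 + t2) c = Some c2.
Proof. by rewrite /run addnC iterD => -> . Qed.

(** [wp] runs for exactly [t] steps, so a processor that finishes early has to idle; idling does not
    increase [nops]. *)
Lemma wp_halted t D i m s (Q : _ -> _ -> Prop) :
  halted prog s -> Q m s -> wp t D i m s Q.
Proof.
move=> halt_s; elim: t m => [|t IHt] m //= Qms; exists s, NoAccess; split=> //.
  by rewrite /local_step onthE nth_default ?size_map.
exact: IHt.
Qed.

(** * Symbolic execution of instructions *)

Local Notation num0 := (@NumW T 0).

(* Listing the registers makes symbolic execution a matter of computation. *)
Definition pstate_of p (l : seq (word T)) (c : nat) : pstate k T :=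
  PState p (fun r => nth num0 l r) c.

Lemma setr_pstate_of p l (c : nat) (r : 'I_k) v :
  setr (pstate_of p l c) r v = pstate_of p.+1 (set_nth num0 l r v) c.+1.
Proof.
rewrite /setr /pstate_of /=; congr PState; apply: functional_extensionality => r'.
by rewrite nth_set_nth /=.
Qed.

Section Rules.

Variables (t : nat) (D : pred 'I_n) (i : 'I_P) (m : 'I_n -> word T).
Variables (p : nat) (l : seq (word T)) (c : nat).
Variable Q : ('I_n -> word T) -> pstate k T -> Prop.

Let after m' p' l' := wp t D i m' (pstate_of p' l' c.+1) Q.
Let before := wp t.+1 D i m (pstate_of p l c) Q.

Lemma wp_set ins (r : 'I_k) v :
    onth prog p = Some ins ->
    exec w e op m i (pstate_of p l c) ins = Some (setr (pstate_of p l c) r v, NoAccess) ->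
  after m p.+1 (set_nth num0 l r v) -> before.
Proof.
move=> insE execE h; exists (setr (pstate_of p l c) r v), NoAccess.
by rewrite setr_pstate_of in execE *; split; rewrite /local_step /= ?insE.
Qed.

Lemma wp_arith o (r u v : 'I_k) a b z :
    onth prog p = Some (Arith o r u v) ->
    nth num0 l u = NumW a -> nth num0 l v = NumW b -> eval_arith w o a b = z ->
  after m p.+1 (set_nth num0 l r (NumW z)) -> before.
Proof. by move=> insE Ea Eb <-; apply: wp_set insE _; rewrite /= Ea Eb. Qed.

Lemma wp_comb (r u v : 'I_k) a b :
    onth prog p = Some (Comb r u v) ->
    nth num0 l u = EltW a -> nth num0 l v = EltW b ->
  after m p.+1 (set_nth num0 l r (EltW (op a b))) -> before.
Proof. by move=> insE Ea Eb; apply: wp_set insE _; rewrite /= Ea Eb. Qed.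

Lemma wp_read (r u : 'I_k) (x : 'I_n) :
    onth prog p = Some (Read r u) -> nth num0 l u = NumW x -> D x ->
  after m p.+1 (set_nth num0 l r (m x)) -> before.
Proof.
move=> E Ex Dx h; exists (pstate_of p.+1 (set_nth num0 l r (m x)) c.+1), (Reads x).
rewrite /local_step /= E /= Ex /= valK /= setr_pstate_of.
by split=> // y [<-].
Qed.

Lemma wp_write (r u : 'I_k) (x : 'I_n) :
    onth prog p = Some (Write u r) -> nth num0 l u = NumW x -> D x ->
  after (update m (Writes x (nth num0 l r))) p.+1 l -> before.
Proof.
move=> E Ex Dx h; exists (pstate_of p.+1 l c.+1), (Writes x (nth num0 l r)).
rewrite /local_step /= E /= Ex /= valK /=.
by split=> // y [<-].
Qed.

Lemma wp_jump p' : onth prog p = Some (Jump k p') -> after m p' l -> before.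
Proof.
move=> E h; exists (pstate_of p' l c.+1), NoAccess.
by split; rewrite /local_step /= ?E.
Qed.

Lemma wp_jumplt (u v : 'I_k) a b p' :
    onth prog p = Some (JumpLt u v p') ->
    nth num0 l u = NumW a -> nth num0 l v = NumW b ->
  after m (if a < b then p' else p.+1) l -> before.
Proof.
move=> E Ea Eb h; exists (pstate_of (if a < b then p' else p.+1) l c.+1), NoAccess.
by split; rewrite /local_step /= ?E /= ?Ea ?Eb.
Qed.

End Rules.

End ParallelComposition.

Arguments wp : simpl never.

(** * The scan program *)

Local Notation reg_ j := (@Ordinal 14 j isT).
Local Notation rI := (reg_ 0).
Local Notation rN := (reg_ 1).
Local Notation rP := (reg_ 2).
Local Notation r1 := (reg_ 3).
Local Notation rX := (reg_ 4).
Local Notation rY := (reg_ 5).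
Local Notation rS := (reg_ 6).
Local Notation rA := (reg_ 7).
Local Notation rB := (reg_ 8).
Local Notation rD := (reg_ 9).
Local Notation rT := (reg_ 10).
Local Notation rV := (reg_ 11).
Local Notation rR := (reg_ 12).
Local Notation rU := (reg_ 13).

(* The instructions that load rV with 0 only equalize the lengths of the two
   branches of a conditional, so that the processors stay in lockstep. *)
Definition scan_prog : program 14 := [::
  Pid rI; Nproc rP; Size rN; Const r1 1; Const rX 2; Const rY 1; Ident rR;
  (* 7: while rX = 2 ^ rY <= P, double rY; halt once rI * rY >= n *)
  JumpLt rP rX 13;
  Arith MulW rX rX rX;
  Arith AddW rY rY rY;
  Arith MulW rT rI rY;
  JumpLt rT rN 7;
  Jump _ 55;
  (* 13: rS is the block size, rA the start of block rI *)
  Arith DivW rS rN rP;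
  Arith AddW rS rS rY;
  Arith MulW rA rI rS;
  JumpLt rA rN 18;
  Jump _ 55;
  Move rD rS;
  Move rB rA;
  (* 20: combine block rI - 1 into rR, from right to left *)
  JumpLt rD r1 30;
  Arith SubW rB rB r1;
  Arith SubW rD rD r1;
  JumpLt rI r1 27;
  Read rV rB;
  Comb rR rV rR;
  Jump _ 20;
  Const rV 0;
  Const rV 0;
  Jump _ 20;
  (* 30: save the first cell of block rI, which then serves as a mailbox *)
  Read rU rA;
  Const rD 1;
  (* 32: pointer jumping over the mailboxes, rD = 1, 2, 4, ... *)
  JumpLt rP rD 45;
  Write rA rR;
  Arith MulW rB rD rS;
  Arith SubW rB rA rB;
  JumpLt rI rD 41;
  Read rV rB;
  Comb rR rV rR;
  Arith AddW rD rD rD;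
  Jump _ 32;
  Arith AddW rD rD rD;
  Const rV 0;
  Const rV 0;
  Jump _ 32;
  (* 45: prefixes of block rI *)
  Arith AddW rS rA rS;
  Write rA rR;
  Comb rR rR rU;
  Arith AddW rA rA r1;
  JumpLt rA rN 51;
  Jump _ 55;
  JumpLt rA rS 53;
  Jump _ 55;
  Read rU rA;
  Jump _ 46].

(** * Block size, folds over intervals, and numerical bounds *)

Section Scan.

Variables (T : Type) (e : T) (op : Monoid.law e) (n P w : nat).
Hypotheses (P_gt0 : 0 < P) (le_P_n : P <= n).
Hypothesis word_size : 4 * (n.+1 * n.+1) <= 2 ^ w.
Variable A : 'I_n -> T.

Let L := trunc_log 2 P.
(** The number of doublings of y, i.e. the least [K] with [P < 2 ^ 2 ^ K]; the final y is [2 ^ K],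
    which replaces log P. *)
Let K := up_log 2 L.+1.
Let s := n %/ P + 2 ^ K.

Implicit Types (i : 'I_P) (D : pred 'I_n) (m : 'I_n -> word T).

Local Notation wps := (@wp w n P 14 T e op scan_prog).
Local Notation st := (@pstate_of 14 T).
Local Notation num0 := (@NumW T 0).

Definition regs (i X Y s a : nat) (b d t v : word T) (r : T) (u : word T) :=
  [:: NumW i; NumW n; NumW P; NumW 1; NumW X; NumW Y; NumW s; NumW a;
      b; d; t; v; EltW r; u].

Definition entry x := if insub x is Some y then A y else e.

Definition fold a b := \big[op/e]_(a <= x < b) entry x.

Lemma entryE (x : 'I_n) : entry x = A x.
Proof. by rewrite /entry valK. Qed.

Lemma fold_nil a : fold a a = e.
Proof. by rewrite /fold big_geq. Qed.

Lemma fold_cat a b c : a <= b -> b <= c -> op (fold a b) (fold b c) = fold a c.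
Proof. by move=> ab bc; rewrite /fold -big_cat_nat. Qed.

Lemma fold1 a : fold a a.+1 = entry a.
Proof. by rewrite /fold big_nat1. Qed.

(** No arithmetic of the program wraps around: a squaring starts from at most [P], and multiples of
    [s <= 3 * n.+1] have factors at most [P]. *)
Lemma word_modE a : a < 4 * (n.+1 * n.+1) -> a %% 2 ^ w = a.
Proof. by move=> lt_a; rewrite modn_small // (leq_trans lt_a). Qed.

(** Together with [tower_gt], this makes every surviving processor leave the doubling loop after
    exactly [K] rounds. *)
Lemma tower_le k : k < K -> 2 ^ 2 ^ k <= P.
Proof.
move=> lt_k_K; apply: leq_trans (trunc_logP (isT : 1 < 2) P_gt0); rewrite leq_exp2l //.
rewrite leqNgt; apply: contraL lt_k_K => lt_L; rewrite -leqNgt.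
exact: up_log_min.
Qed.

Lemma tower_gt : P < 2 ^ 2 ^ K.
Proof.
apply: leq_trans (trunc_log_ltn P (isT : 1 < 2)) _; rewrite leq_exp2l //.
exact: up_logP.
Qed.

Lemma L_le : L <= P.
Proof.
by apply: leq_trans (ltnW (ltn_expl L (isT : 1 < 2))) _; apply: trunc_logP.
Qed.

(** By minimality of [K], half of [2 ^ K] is at most [L]; the successor covers [K = 0]. *)
Lemma pow_K_le : 2 ^ K <= L.*2.+1.
Proof.
case EK: K => [|k] //; rewrite expnS.
have := @tower_le k; rewrite EK ltnSn => /(_ isT) le_P.
suff : 2 ^ k <= L by lia.
rewrite /L; exact: trunc_log_max.
Qed.

Lemma s_le : s <= 3 * n.+1.
Proof.
have := pow_K_le; have := L_le; have := leq_div n P; rewrite /s; lia.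
Qed.

Lemma s_gt0 : 0 < s.
Proof. by rewrite /s addn_gt0 orbC expn_gt0. Qed.

(** * Loops of a single processor *)

(* Here j doublings of y are still to come. *)
Lemma wp_shrink t D i m j k c tm Q :
    k + j = K -> i * 2 ^ k < n ->
    (i * 2 ^ K < n -> forall tm,
      wps t D i m (st 13 (regs i (2 ^ 2 ^ K) (2 ^ K) 0 0 num0 num0 tm num0 e num0)
        (c + 5 * j + 1)) Q) ->
    (n <= i * 2 ^ K -> forall l c', c' <= c + 1 + 5 * \sum_(k <= k' < K) (i * 2 ^ k' < n) ->
       Q m (st 55 l c')) ->
  wps (5 * j + 1 + t) D i m
    (st 7 (regs i (2 ^ 2 ^ k) (2 ^ k) 0 0 num0 num0 tm num0 e num0) c) Q.
Proof.
have lt_i := ltn_ord i.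
elim: j k c tm => [|j IHj] k c tm.
  rewrite addn0 => -> lt_in Hact _; rewrite muln0 !add0n add1n.
  apply: (wp_jumplt (u := rP) (v := rX)) => //; rewrite tower_gt.
  by move/(_ lt_in tm): Hact; rewrite muln0 addn0 addn1.
move=> Ek lt_in Hact Hhalt.
have lt_k : k < K by lia.
have le_X := tower_le lt_k.
have lt_Y : 2 ^ k < 2 ^ 2 ^ k by apply: ltn_expl.
have -> : 5 * j.+1 + 1 + t = (5 * j + 1 + t).+4.+1 by lia.
apply: (wp_jumplt (u := rP) (v := rX)) => //; rewrite ltnNge le_X /=.
apply: (wp_arith (z := 2 ^ 2 ^ k.+1)) => //=.
  by rewrite -expnD addnn -mul2n -expnS word_modE // expnS mul2n -addnn expnD; nia.
apply: (wp_arith (z := 2 ^ k.+1)) => //=.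
  by rewrite addnn -mul2n -expnS word_modE // expnS; nia.
apply: (wp_arith (z := i * 2 ^ k.+1)) => //=.
  by rewrite word_modE // expnS; nia.
apply: (wp_jumplt (u := rT) (v := rN)) => //=; case: ltnP => [lt_in' | ge_in'].
  apply: IHj => //; first by lia.
    move=> lt_iK tm'.
    have -> : c.+4.+1 + 5 * j + 1 = c + 5 * j.+1 + 1 by lia.
    exact: Hact.
  move=> ge_iK l c' le_c'; apply: Hhalt => //; apply: leq_trans le_c' _.
  by rewrite [in X in _ <= X]big_ltn // lt_in; lia.
have -> : 5 * j + 1 + t = (5 * j + t).+1 by lia.
apply: wp_jump => //; apply: wp_halted => //; apply: Hhalt.
  by rewrite (leq_trans ge_in') // leq_mul2l leq_exp2l // lt_k orbT.
(* The aborted round costs 5 instructions, charged to term [k] of the sum; the [+ 1] pays for the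
   jump to the end. *)
by rewrite big_ltn // lt_in; lia.
Qed.

(** Here [j] entries remain. Going from right to left lets each new entry be combined on the left,
    which respects a noncommutative [op]. *)
Lemma wp_sum_block t D i m j X Y c tm v u Q :
    j <= s -> i * s < n -> (forall x, m x = EltW (entry x)) ->
    (forall x : 'I_n, 0 < i -> i.-1 * s <= x < i * s -> D x) ->
    (forall b tm v, wps t D i m
       (st 30 (regs i X Y s (i * s) b num0 tm v (fold (i * s - s) (i * s)) u)
         (c + 7 * j + 1)) Q) ->
  wps (7 * j + 1 + t) D i m
    (st 20 (regs i X Y s (i * s) (NumW (i * s - (s - j))) (NumW j) tm v
       (fold (i * s - (s - j)) (i * s)) u) c) Q.
Proof.
move=> le_js lt_is mE memD; have s0 := s_gt0.
elim: j c tm v le_js => [|j IHj] c tm v le_js Hend.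
  rewrite muln0 !add0n add1n; apply: (wp_jumplt (u := rD) (v := r1)) => //=.
  by move: (Hend (NumW (i * s - (s - 0))) tm v); rewrite muln0 addn0 addn1 subn0.
have -> : 7 * j.+1 + 1 + t = (7 * j + 1 + t).+4.+3 by lia.
apply: (wp_jumplt (u := rD) (v := r1)) => //=.
apply: (wp_arith (z := i * s - (s - j))) => //=; first by lia.
apply: (wp_arith (z := j)) => //=; first by lia.
have IH v' := IHj c.+4.+3 tm v' (ltnW le_js).
have Ec : c.+4.+3 + 7 * j + 1 = c + 7 * j.+1 + 1 by lia.
rewrite Ec in IH.
apply: (wp_jumplt (u := rI) (v := r1)) => //=; case: ltnP => [lt_i1 | ge_i1].
  have i0 : i = 0 :> nat by lia.
  apply: (wp_set (r := rV) (v := num0)) => //=; first by rewrite mod0n.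
  apply: (wp_set (r := rV) (v := num0)) => //=; first by rewrite mod0n.
  apply: wp_jump => //.
  (* Truncated subtraction makes both ends of the fold 0: processor 0 only counts down and keeps the
     identity. *)
  by have := IH num0 Hend; rewrite i0 mul0n !sub0n.
have lt_x : i * s - (s - j) < n by lia.
apply: (wp_read (r := rV) (u := rB) (x := Ordinal lt_x)) => //=.
  by apply: memD => //=; rewrite -subn1 mulnBl; nia.
rewrite mE; apply: (wp_comb (a := entry (i * s - (s - j)))) => //.
apply: wp_jump => //=.
have -> : op (entry (i * s - (s - j))) (fold (i * s - (s - j.+1)) (i * s)) =
    fold (i * s - (s - j)) (i * s).
  have -> : i * s - (s - j.+1) = (i * s - (s - j)).+1 by nia.
  by rewrite -fold1 fold_cat //; nia.
exact: IH.
Qed.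

(** [rS] now holds the end [f] of the block, and [minn n f] allows for a short last block. Nothing
    is assumed of cell [a]: its entry is already in [rU], and at the start of a block the cell holds
    a mailbox. *)
Lemma wp_write_block t D i m j X Y a a0 f c b d tm v Q :
    a + j = minn n f -> a < n -> a < f -> f <= 4 * n.+1 ->
    (forall x : 'I_n, a0 <= x < f -> D x) -> a0 <= a ->
    (forall x : 'I_n, a0 <= x < a -> m x = EltW (fold 0 x)) ->
    (forall x : 'I_n, a < x < f -> m x = EltW (entry x)) ->
    (forall m l c', c' <= c + 7 * j ->
       (forall x : 'I_n, a0 <= x < f -> m x = EltW (fold 0 x)) -> Q m (st 55 l c')) ->
  wps (7 * j + t) D i m
    (st 46 (regs i X Y f a b d tm v (fold 0 a) (EltW (entry a))) c) Q.
Proof.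
move=> Ej ltan ltaf le_f memD le_a0.
elim: j a c m Ej ltan ltaf le_a0 => [|j IHj] a c m Ej ltan ltaf le_a0 mL mR Hend.
  by lia.
have -> : 7 * j.+1 + t = (7 * j + t).+4.+3 by lia.
apply: (wp_write (u := rA) (r := rR) (x := Ordinal ltan)) => //=.
  by apply: memD; rewrite /= le_a0.
apply: (wp_comb (a := fold 0 a) (b := entry a)) => //=.
apply: (wp_arith (z := a.+1)) => //=; first by rewrite addn1 word_modE //; nia.
rewrite -fold1 fold_cat //.
set m' := update _ _.
have m'E (x : 'I_n) : m' x = if x == a :> nat then EltW (fold 0 a) else m x.
  by rewrite /m' /update /= -val_eqE /= eq_sym; case: eqP.
have m'L (x : 'I_n) : a0 <= x < a.+1 -> m' x = EltW (fold 0 x).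
  by rewrite m'E; case: eqP => [-> // | neq] lt_x; apply: mL; lia.
apply: (wp_jumplt (u := rA) (v := rN)) => //=; case: ltnP => [lt_an' | ge_an'].
  apply: (wp_jumplt (u := rA) (v := rS)) => //=; case: ltnP => [lt_af' | ge_af'].
    apply: (wp_read (r := rU) (u := rA) (x := Ordinal lt_an')) => //=.
      by apply: memD; rewrite /= lt_af'; lia.
    apply: wp_jump => //=.
    have -> : m' (Ordinal lt_an') = EltW (entry a.+1).
      by rewrite m'E /= ifF ?mR //=; lia.
    apply: IHj => //; first by lia.
    - by lia.
    - by move=> x lt_x; rewrite m'E ifF; [apply: mR | ]; lia.
    - by move=> m'' l c' le_c'; apply: Hend; lia.
  apply: wp_jump => //=; apply: wp_halted => //.
  by apply: Hend => [|x lt_x]; [lia | apply: m'L; lia].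
apply: wp_jump => //=; apply: wp_halted => //.
by apply: Hend => [|x lt_x]; [lia | apply: m'L; have := ltn_ord x; lia].
Qed.

(** * Synchronous phases *)

(* The sum counts the doublings of y that processor i survives. *)
Definition lockstep p t d (R : nat -> T) (u : nat -> word T) (c : config n P 14 T) :=
  forall i : 'I_P, if i * s < n then
    exists b tm v,
      proc c i = st p (regs i (2 ^ 2 ^ K) (2 ^ K) s (i * s) b (NumW d) tm v (R i) (u i)) t
  else exists l t', proc c i = st 55 l t'
         /\ t' <= 14 + 5 * \sum_(0 <= k < K) (i * 2 ^ k < n).

Definition mailboxes (M : nat -> T) (c : config n P 14 T) :=
  forall x : 'I_n,
    shared c x = EltW (if x %% s == 0 then M (x %/ s) else entry x).

Local Notation run := (@run w n P 14 T e op scan_prog).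

Lemma block_index g x : g * s <= x < g * s + s -> x %/ s = g.
Proof.
move=> x_block; have s0 := s_gt0.
by rewrite -(subnKC (proj1 (andP x_block))) divnMDl // divn_small; lia.
Qed.

Lemma block_start g x : x %/ s = g -> x %% s == 0 -> x = g * s.
Proof. by move=> <- /eqP xs; rewrite {1}(divn_eq x s) xs addn0. Qed.

Lemma phase1 : exists c t, [/\ run t (initial P 14 A) = Some c,
  t <= 15 + 5 * K + 7 * s,
  mailboxes (fun g => entry (g * s)) c
  & lockstep 30 t 0 (fun g => fold (g * s - s) (g * s)) (fun=> num0) c].
Proof.
have s0 := s_gt0.
(* Each participant reads only the block before its own; processor 0 reads nothing. *)
pose D (i : 'I_P) (x : 'I_n) := [&& i * s < n, 0 < i & x %/ s == i.-1].
(* Initialization, doubling loop, block size and test, two moves, summation loop. *)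
pose t := 7 + (5 * K + 1 + (4 + (2 + (7 * s + 1 + 0)))).
have [|//||c [runE memN Qc]] := @run_par w n P 14 T e op scan_prog t (initial P 14 A)
  (fun=> shared (initial P 14 A)) D
  (fun i m q => (forall x, m x = EltW (entry x)) /\
    if i * s < n then
    exists b tm v,
      q = st 30 (regs i (2 ^ 2 ^ K) (2 ^ K) s (i * s) b num0 tm v
            (fold (i * s - s) (i * s)) num0) t
  else exists l t', q = st 55 l t'
         /\ t' <= 14 + 5 * \sum_(0 <= k < K) (i * 2 ^ k < n)).
- move=> i j x /and3P[_ i0 /eqP Ei] /and3P[_ j0 /eqP Ej]; apply: val_inj => /=; lia.
- move=> i; have lt_i := ltn_ord i.
  have -> : proc (initial P 14 A) i = st 0 (nseq 14 num0) 0.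
    rewrite /pstate_of /=; congr PState; apply: functional_extensionality => r.
    by rewrite (nth_nseq num0 14 num0) if_same.
  set m := shared _; have mE x : m x = EltW (entry x) by rewrite /m /= entryE.
  rewrite /t; apply: (wp_set (r := rI) (v := NumW i)) => //=; first by rewrite word_modE //; nia.
  apply: (wp_set (r := rP) (v := NumW P)) => //=; first by rewrite word_modE //; nia.
  apply: (wp_set (r := rN) (v := NumW n)) => //=; first by rewrite word_modE //; nia.
  apply: (wp_set (r := r1) (v := NumW 1)) => //=; first by rewrite word_modE //; nia.
  apply: (wp_set (r := rX) (v := NumW 2)) => //=; first by rewrite word_modE //; nia.
  apply: (wp_set (r := rY) (v := NumW 1)) => //=; first by rewrite word_modE //; nia.
  apply: (wp_set (r := rR) (v := EltW e)) => //=.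
  apply: (@wp_shrink _ _ _ _ K 0 7 num0) => //; first by rewrite muln1; lia.
    move=> lt_iK tm; have le_s := s_le.
    have le_q := leq_div n P; have le_K := pow_K_le; have le_L := L_le.
    apply: (wp_arith (z := n %/ P)) => //=.
    apply: (wp_arith (z := s)) => //=; first by rewrite word_modE //; nia.
    apply: (wp_arith (z := i * s)) => //=; first by rewrite word_modE //; nia.
    apply: (wp_jumplt (u := rA) (v := rN)) => //=; case: ltnP => [lt_is | ge_is].
      apply: (wp_set (r := rD) (v := NumW s)) => //=.
      apply: (wp_set (r := rB) (v := NumW (i * s))) => //=.
      have := @wp_sum_block 0 (D i) i m s (2 ^ 2 ^ K) (2 ^ K) (7 + 5 * K + 1).+4.+2 tm num0 num0.
      rewrite subnn subn0 fold_nil; apply=> //.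
        move=> x i0 /andP[x1 x2]; rewrite /D lt_is i0 /=; apply/eqP; apply: block_index.
        by have := mulSn i.-1 s; rewrite prednK //; lia.
      move=> b tm' v; split=> //; exists b, tm', v; congr pstate_of; lia.
    apply: wp_jump => //; apply: wp_halted => //; split=> //.
    do 2 eexists; split; first by [].
    (* Having survived the whole loop, the processor contributes 1 to every term. *)
    have -> : \sum_(0 <= k < K) (i * 2 ^ k < n) = K; last by lia.
    rewrite (eq_big_nat _ _ (F2 := fun=> 1)) ?sum_nat_const_nat ?subn0 ?muln1 // => k.
    move=> lt_k; rewrite (leq_ltn_trans _ lt_iK) // leq_mul2l leq_exp2l //; lia.
  (* Since [2 ^ K <= s], a processor dropped by the doubling loop has no block, so [i * s < n] alone
     decides who takes part. *)
  move=> ge_iK l c' le_c'; split=> //; rewrite ifF; last first.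
    by apply/negbTE; rewrite -leqNgt (leq_trans ge_iK) // leq_mul2l /s leq_addl orbT.
  by exists l, c'; split=> //; lia.
exists c, t; split=> //; first by rewrite /t; lia.
  have shE x : shared c x = EltW (entry x).
    have [/existsP[i Dix] | /existsPn Dx] := boolP [exists i, D i x].
      by have [m [[mE _] ->]] := Qc i.
    by rewrite memN // /= entryE.
  move=> x; rewrite shE; case: eqP => // xs.
  by rewrite {1}(divn_eq x s) xs addn0.
by move=> i; have [m [[_ Qi] _]] := Qc i.
Qed.

Section Phase.

Variables (t p d : nat) (R : nat -> T) (u : nat -> word T).
Variables (c : config n P 14 T) (nops : nat).
Variables (p' d' : nat) (R' : nat -> T) (u' : nat -> word T).
Variables (D : 'I_P -> pred 'I_n) (mpost : 'I_P -> ('I_n -> word T) -> Prop).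

(** Disposes of the halted processors once and for all: a phase has only to be checked for
    participants, on the cells it assigns to them. *)
Lemma lockstep_phase :
    lockstep p nops d R u c ->
    (forall i j x, D i x -> D j x -> i = j) ->
    (forall i : 'I_P, i * s < n -> forall b tm v,
      wps t (D i) i (shared c)
        (st p (regs i (2 ^ 2 ^ K) (2 ^ K) s (i * s) b (NumW d) tm v (R i) (u i)) nops)
        (fun m q => mpost i m /\ exists b tm v,
           q = st p' (regs i (2 ^ 2 ^ K) (2 ^ K) s (i * s) b (NumW d') tm v (R' i) (u' i))
                 (nops + t))) ->
  exists c', [/\ run t c = Some c', lockstep p' (nops + t) d' R' u' c',
    forall x, (forall i, ~~ D i x) -> shared c' x = shared c x
    & forall i, i * s < n -> exists m, mpost i m /\ forall x, D i x -> shared c' x = m x].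
Proof.
move=> lock disj phase.
have [//||c' [runE memN Qc]] := @run_par w n P 14 T e op scan_prog t c (fun=> shared c) D
  (fun i m q => if i * s < n then
     mpost i m /\ exists b tm v,
       q = st p' (regs i (2 ^ 2 ^ K) (2 ^ K) s (i * s) b (NumW d') tm v (R' i) (u' i))
             (nops + t)
   else exists l t', q = st 55 l t'
         /\ t' <= 14 + 5 * \sum_(0 <= k < K) (i * 2 ^ k < n)) disj.
- move=> i; move: (lock i); case: ifP => lt_is [].
    by move=> b [tm [v ->]]; apply: phase.
  move=> l [t' [-> le_t']]; apply: wp_halted => //.
  by exists l, t'.
exists c'; split=> // i; have [m [Qm memD]] := Qc i; first by move: Qm; case: ifP => // _ [].
by move=> lt_is; exists m; rewrite lt_is in Qm; case: Qm.
Qed.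

End Phase.

Lemma mul_s_inj : injective (muln^~ s).
Proof.
by move=> g h /eqP; rewrite /= eqn_pmul2r ?s_gt0 // => /eqP.
Qed.

(** The factor [1] prepares the invariant of pointer jumping: at distance [d], [rR] combines the [d]
    blocks before block [g]. *)
Lemma phase_save c t :
    lockstep 30 t 0 (fun g => fold (g * s - s) (g * s)) (fun=> num0) c ->
    mailboxes (fun g => entry (g * s)) c ->
  exists c', [/\ run 2 c = Some c', mailboxes (fun g => entry (g * s)) c'
    & lockstep 32 (t + 2) 1 (fun g => fold (g * s - 1 * s) (g * s))
        (fun g => EltW (entry (g * s))) c'].
Proof.
have s0 := s_gt0.
pose D (i : 'I_P) (x : 'I_n) := x == i * s :> nat.
move=> lock mail.
have [||c' [runE lock' memN memD]] := @lockstep_phase 2 30 0 _ _ c t 32 1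
    (fun g => fold (g * s - 1 * s) (g * s)) (fun g => EltW (entry (g * s)))
    D (fun _ m => m = shared c) lock.
- by move=> i j x /eqP Ei /eqP Ej; apply/val_inj/mul_s_inj; rewrite -Ei -Ej.
- move=> i lt_is b tm v.
  apply: (wp_read (r := rU) (u := rA) (x := Ordinal lt_is)) => //=; first by rewrite /D /=.
  apply: (wp_set (r := rD) (v := NumW 1)) => //=; first by rewrite word_modE //; nia.
  split=> //; exists b, tm, v; rewrite mail /= modnMl eqxx mulnK // mul1n addn2.
  by [].
exists c'; split=> // x; rewrite -mail.
have [/existsP[i Dix] | /existsPn Dx] := boolP [exists i, D i x]; last exact: memN.
have lt_is : i * s < n by rewrite -(eqP Dix).
by have [m [-> ->]] := memD i lt_is.
Qed.

Lemma phase_post c t d R M u :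
    d <= P -> lockstep 32 t d R u c -> mailboxes M c ->
  exists c', [/\ run 2 c = Some c', mailboxes R c' & lockstep 34 (t + 2) d R u c'].
Proof.
have s0 := s_gt0.
pose D (i : 'I_P) (x : 'I_n) := x == i * s :> nat.
move=> le_dP lock mail.
have [||c' [runE lock' memN memD]] := @lockstep_phase 2 32 d _ _ c t 34 d R u
    D (fun i m => forall x, D i x -> m x = EltW (R i)) lock.
- by move=> i j x /eqP Ei /eqP Ej; apply/val_inj/mul_s_inj; rewrite -Ei -Ej.
- move=> i lt_is b tm v.
  apply: (wp_jumplt (u := rP) (v := rD)) => //=; rewrite ltnNge le_dP /=.
  apply: (wp_write (u := rA) (r := rR) (x := Ordinal lt_is)) => //=; first by rewrite /D /=.
  split; last by exists b, tm, v; rewrite addn2.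
  by move=> x Dx; rewrite /update /= -val_eqE /= eq_sym (eqP Dx) eqxx.
exists c'; split=> // x; case: ifP => [xs | xs].
  (* As [s] exceeds [n %/ P], we have [n < P * s], so every block has a processor. *)
  have lt_i : x %/ s < P.
    have := ltn_ord x; rewrite ltn_divLR // => /leq_trans; apply.
    have := ltn_ceil n P_gt0; rewrite /s; have := expn_gt0 2 K; nia.
  have xE := block_start (erefl (x %/ s)) xs.
  have [|m [mD ->]] := memD (Ordinal lt_i); first by rewrite /= -xE.
    by rewrite mD /D /= -?xE.
  by rewrite /D /= -xE.
rewrite memN ?mail ?xs // => i; apply/eqP => xE.
by rewrite xE modnMl eqxx in xs.
Qed.

(** Processor [i] now owns the mailbox of [i - d], and this shift is injective for [d <= i]. Posting
    and reading are separate phases, so mailboxes can change owner in between. *)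
Lemma phase_jump c t d R u :
    d <= P -> lockstep 34 t d R u c -> mailboxes R c ->
  exists c', [/\ run 7 c = Some c', mailboxes R c'
    & lockstep 32 (t + 7) (d + d) (fun g => if g < d then R g else op (R (g - d)) (R g)) u c'].
Proof.
have s0 := s_gt0; have le_s := s_le.
pose D (i : 'I_P) (x : 'I_n) := [&& i * s < n, d <= i & x == (i - d) * s :> nat].
move=> le_dP lock mail.
have [||c' [runE lock' memN memD]] := @lockstep_phase 7 34 d _ _ c t 32 (d + d)
    (fun g => if g < d then R g else op (R (g - d)) (R g)) u
    D (fun i m => m = shared c) lock.
- move=> i j x /and3P[_ le_di /eqP Ei] /and3P[_ le_dj /eqP Ej].
  have : i - d = j - d by apply: mul_s_inj; rewrite -Ei -Ej.
  by move=> Eij; apply: val_inj => /=; lia.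
- move=> i lt_is b tm v.
  apply: (wp_arith (z := d * s)) => //=; first by rewrite word_modE //; nia.
  apply: (wp_arith (z := (i - d) * s)) => //=; first by rewrite mulnBl.
  apply: (wp_jumplt (u := rI) (v := rD)) => //=; case: ltnP => [lt_id | ge_id].
    apply: (wp_arith (z := d + d)) => //=; first by rewrite word_modE //; nia.
    apply: (wp_set (r := rV) (v := num0)) => //=; first by rewrite mod0n.
    apply: (wp_set (r := rV) (v := num0)) => //=; first by rewrite mod0n.
    apply: wp_jump => //=; split=> //.
    by do 3 eexists; rewrite addnC.
  have lt_x : (i - d) * s < n by rewrite mulnBl; lia.
  apply: (wp_read (r := rV) (u := rB) (x := Ordinal lt_x)) => //=.
    by rewrite /D lt_is ge_id /=.
  rewrite mail /= modnMl eqxx mulnK //.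
  apply: (wp_comb (a := R (i - d)) (b := R i)) => //=.
  apply: (wp_arith (z := d + d)) => //=; first by rewrite word_modE //; nia.
  apply: wp_jump => //=; split=> //.
  by do 3 eexists; rewrite addnC.
exists c'; split=> // x; rewrite -mail.
have [/existsP[i Dix] | /existsPn Dx] := boolP [exists i, D i x]; last exact: memN.
have /and3P[lt_is _ _] := Dix.
by have [m [-> ->]] := memD i lt_is.
Qed.

Lemma lockstep_eq p t d R R' u c :
  (forall g, R g = R' g) -> lockstep p t d R u c -> lockstep p t d R' u c.
Proof. by move=> eqR lock i; rewrite -eqR; exact: lock. Qed.

(** The two runs of [d] blocks are adjacent. For [g < d] truncation already starts the fold at 0, so
    nothing is to be added. *)
Lemma fold_jump d g :
  (if g < d then fold (g * s - d * s) (g * s)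
   else op (fold ((g - d) * s - d * s) ((g - d) * s)) (fold (g * s - d * s) (g * s))) =
  fold (g * s - (d + d) * s) (g * s).
Proof.
rewrite mulnDl; case: ltnP => [lt_gd | le_dg].
  by have := leq_mul (ltnW lt_gd) (leqnn s); move=> le_gd; congr fold; lia.
have le_gd := leq_mul le_dg (leqnn s).
rewrite mulnBl fold_cat; [congr fold; lia | lia | lia].
Qed.

(** A round is 2 steps of posting and 7 of jumping. The final mailboxes [M] lag behind the registers
    and stay unspecified; later phases do not depend on them. *)
Lemma phase_rounds c t r : r <= L.+1 ->
    lockstep 32 t 1 (fun g => fold (g * s - 1 * s) (g * s))
      (fun g => EltW (entry (g * s))) c ->
    mailboxes (fun g => entry (g * s)) c ->
  exists c' M, [/\ run (9 * r) c = Some c', mailboxes M c'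
    & lockstep 32 (t + 9 * r) (2 ^ r) (fun g => fold (g * s - 2 ^ r * s) (g * s))
        (fun g => EltW (entry (g * s))) c'].
Proof.
elim: r => [|r IHr] lt_r lock mail.
  by exists c, (fun g => entry (g * s)); rewrite muln0 addn0.
have [c1 [M [run1 mail1 lock1]]] := IHr (ltnW lt_r) lock mail.
have le_P : 2 ^ r <= P.
  apply: leq_trans (trunc_logP (isT : 1 < 2) P_gt0).
  by rewrite leq_exp2l.
have [c2 [run2 mail2 lock2]] := phase_post le_P lock1 mail1.
have [c3 [run3 mail3 lock3]] := phase_jump le_P lock2 mail2.
exists c3; eexists; split; [|exact: mail3|].
  rewrite mulnS addnC; apply: run_add run1 _.
  exact: (@run_add _ _ _ _ _ _ _ _ 2 7 _ _ _ run2 run3).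
have -> : t + 9 * r.+1 = t + 9 * r + 2 + 7 by lia.
rewrite expnS mul2n -addnn; apply: lockstep_eq lock3 => g; exact: fold_jump.
Qed.

(** Since [d] exceeds every processor index, each fold in [rR] starts at 0: it is the prefix of the
    block. *)
Lemma phase_write c t d M :
    P < d ->
    lockstep 32 t d (fun g => fold (g * s - d * s) (g * s))
      (fun g => EltW (entry (g * s))) c ->
    mailboxes M c ->
  exists c', [/\ run (2 + 7 * s) c = Some c',
    forall x : 'I_n, shared c' x = EltW (fold 0 x)
    & forall i, exists l t', proc c' i = st 55 l t' /\
        t' <= 14 + 5 * \sum_(0 <= k < K) (i * 2 ^ k < n)
                + (i * s < n) * (t + 2 + 7 * s)].
Proof.
move=> lt_Pd lock mail; have s0 := s_gt0; have le_s := s_le.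
pose D (i : 'I_P) (x : 'I_n) := (i * s < n) && (x %/ s == i).
have [|//||c' [runE memN Qc]] := @run_par w n P 14 T e op scan_prog (2 + 7 * s) c
    (fun=> shared c) D
    (fun i m q => (forall x, D i x -> m x = EltW (fold 0 x)) /\
       exists l t', q = st 55 l t' /\
         t' <= 14 + 5 * \sum_(0 <= k < K) (i * 2 ^ k < n) + (i * s < n) * (t + 2 + 7 * s)).
- move=> i j x /andP[_ /eqP Ei] /andP[_ /eqP Ej]; apply: val_inj => /=; lia.
- move=> i; move: (lock i); case: (ltnP (i * s) n) => [lt_is | ge_is].
    move=> [b [tm [v ->]]]; have lt_i := ltn_ord i.
    apply: (wp_jumplt (u := rP) (v := rD)) => //=; rewrite lt_Pd.
    apply: (wp_arith (z := i * s + s)) => //=; first by rewrite word_modE //; nia.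
    have -> : i * s - d * s = 0.
      by apply/eqP; rewrite subn_eq0 leq_mul2r; apply/orP; right; lia.
    pose j := minn n (i * s + s) - i * s.
    have le_j : j <= s by rewrite /j; lia.
    (* Only [j] cells of the block lie in the array; the remaining time is spent idle. *)
    have -> : 7 * s = 7 * j + 7 * (s - j) by lia.
    apply: (@wp_write_block _ _ i _ _ _ _ _ (i * s)) => //.
    + by rewrite /j; lia.
    + by lia.
    + by nia.
    + by move=> x x_block; rewrite /D lt_is; apply/eqP; exact: block_index.
    + by lia.
    + move=> x x_block; rewrite mail ifF //; apply/negbTE/eqP => xs.
      have xE : x %/ s = i by apply: block_index; lia.
      by have := divn_eq x s; rewrite xE xs; lia.
    move=> m l t' le_t' mE; split.
      move=> x /andP[_ /eqP xi]; apply: mE.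
      by rewrite -xi leq_trunc_div /= addnC -mulSn ltn_ceil.
    by exists l, t'; split=> //; rewrite mul1n; lia.
  move=> [l [t' [-> le_t']]]; apply: wp_halted => //; split.
    by move=> x /andP[lt_is]; lia.
  by exists l, t'; split=> //; lia.
exists c'; split=> // [x | i]; last by have [m [[_ Qi] _]] := Qc i.
have lt_i : x %/ s < P.
  have := ltn_ord x; rewrite ltn_divLR // => /leq_trans; apply.
  have := ltn_ceil n P_gt0; rewrite /s; have := expn_gt0 2 K; nia.
have Dx : D (Ordinal lt_i) x.
  by rewrite /D /= eqxx andbT (leq_ltn_trans (leq_trunc_div _ _)).
have [m [[mE _] ->//]] := Qc (Ordinal lt_i).
exact: mE.
Qed.

Lemma scan_run : exists t final, [/\ run t (initial P 14 A) = Some final,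
  forall x : 'I_n, shared final x = EltW (fold 0 x)
  & forall i, exists l t', proc final i = st 55 l t' /\
      t' <= 14 + 5 * \sum_(0 <= k < K) (i * 2 ^ k < n)
              + (i * s < n) * (28 + 14 * s + 5 * K + 9 * L)].
Proof.
have [c1 [t1 [run1 le_t1 mail1 lock1]]] := phase1.
have [c2 [run2 mail2 lock2]] := phase_save lock1 mail1.
have [c3 [M [run3 mail3 lock3]]] := phase_rounds (leqnn _) lock2 mail2.
have [c4 [run4 mem4 nops4]] := phase_write (trunc_log_ltn P (isT : 1 < 2)) lock3 mail3.
eexists; exists c4; split=> //.
  exact: run_add (run_add (run_add run1 run2) run3) run4.
move=> i; have [l [t' [procE le_t']]] := nops4 i; exists l, t'; split=> //.
(* Adding up the phases: [15 + 2 + 9 + 2 = 28], and [7 * s] occurs twice. *)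
by apply: leq_trans le_t' _; rewrite leq_add2l leq_mul2l; apply/orP; right; rewrite -/L; lia.
Qed.

(** * Final values and total cost *)

Lemma fold_prefix (x : 'I_n) : fold 0 x = prefix_value op A x.
Proof.
rewrite /fold big_mkord (big_ord_widen n entry (ltnW (ltn_ord x))).
by apply: eq_bigr => j _; rewrite entryE.
Qed.

Lemma sum_lt_le N b : \sum_(i < N) (i < b) <= b.
Proof.
suff -> : \sum_(i < N) (i < b) = minn N b by apply: geq_minr.
by elim: N => [|N IHN]; rewrite ?big_ord0 ?big_ord_recr /= ?IHN; lia.
Qed.

Lemma count_blocks b : 0 < b -> \sum_(i < P) (i * b < n) <= (n %/ b).+1.
Proof.
move=> b_gt0; apply: leq_trans (sum_lt_le P _); apply: leq_sum => i _.
by case: ltnP => // lt_in; rewrite ltnS leq_divRL // (ltnW lt_in).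
Qed.

(** A geometric series with its tail kept, so that induction closes: twice the next quotient is at
    most the current one. *)
Lemma sum_halves k0 : \sum_(0 <= k < k0) n %/ 2 ^ k + 2 * (n %/ 2 ^ k0) <= 2 * n.
Proof.
elim: k0 => [|k0 IHk]; first by rewrite big_geq // divn1.
rewrite big_nat_recr //= expnSr divnMA; have := leq_trunc_div (n %/ 2 ^ k0) 2; lia.
Qed.

(** Exchanging the sums counts the survivors of each round instead of the rounds of each
    processor. *)
Lemma sum_shrink :
  \sum_(i < P) \sum_(0 <= k < K) (i * 2 ^ k < n) <= 2 * n + K.
Proof.
rewrite exchange_big /=; apply: leq_trans (_ : \sum_(0 <= k < K) (n %/ 2 ^ k + 1) <= _).
  by apply: leq_sum => k _; rewrite addn1 count_blocks ?expn_gt0.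
rewrite big_split /= sum_nat_const_nat subn0 muln1 leq_add2r.
exact: leq_trans (leq_addr _ _) (sum_halves K).
Qed.

Lemma scan_spec : exists t (final : config n P 14 T),
  [/\ run t (initial P 14 A) = Some final, all_halted scan_prog final,
      forall i : 'I_n, shared final i = EltW (prefix_value op A i),
      work final <= 500 * n & span final <= 500 * (n %/ P + L)].
Proof.
have [t [final [runE memE procE]]] := scan_run.
have le_K := pow_K_le; have lt_K := ltn_expl K (isT : 1 < 2).
have le_L : L < 2 ^ K by exact: up_logP.
have le_LP := L_le; have le_q := leq_div n P; have s0 := s_gt0.
(* This absorbs the additive constants of the span, even when [P = 1] and [L = 0]. *)
have q_gt0 : 0 < n %/ P by rewrite divn_gt0.
exists t, final; split=> //.
- by apply/forallP => i; have [l [t' [-> _]]] := procE i.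
- by move=> x; rewrite memE fold_prefix.
- apply: leq_trans (_ : \sum_(i < P) (14 + 5 * \sum_(0 <= k < K) (i * 2 ^ k < n)
      + (i * s < n) * (56 * s)) <= _).
    apply: leq_sum => i _; have [l [t' [-> le_t']]] := procE i.
    apply: leq_trans le_t' _; rewrite leq_add2l leq_mul2l; apply/orP; right.
    (* Each of 1, [K] and [L] is at most [s], and [28 + 14 + 5 + 9 = 56]. *)
    by rewrite /s; lia.
  rewrite 2!big_split /= sum_nat_const card_ord.
  rewrite -(big_distrr 5) -(big_distrl (56 * s)) /=.
  have le_count := count_blocks s0; have le_shrink := sum_shrink.
  have le_mul : (\sum_(i < P) (i * s < n)) * (56 * s) <= 56 * (n + s).
    have := leq_trunc_div n s; nia.
  have le_s : s <= n + 2 * n + 1 by rewrite /s; lia.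
  move: le_mul le_shrink; set a := _ * (56 * s); set b := \sum_(i < P) _.
  by lia.
- apply/bigmax_leqP => i _; have [l [t' [-> le_t']]] := procE i.
  apply: leq_trans le_t' _ => /=.
  have : \sum_(0 <= k < K) (i * 2 ^ k < n) <= K.
    rewrite -[X in _ <= X](muln1 K) -[X in X * 1]subn0 -sum_nat_const_nat.
    by apply: leq_sum => k _; case: (_ < _).
  have : (i * s < n) * (28 + 14 * s + 5 * K + 9 * L) <= 28 + 14 * s + 5 * K + 9 * L.
    by case: (_ < _); lia.
  by rewrite /s; lia.
Qed.

End Scan.

(* One program, with k private words per processor, is run by c * p processors
   and must work at every word size w of at least C * (log n + 1) bits.
   Both n %/ p and trunc_log 2 p are rounded down. *)
Theorem theorem14 :
  exists (k : nat) (prog : program k) (c C : nat),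
  forall (T : Type) (e : T) (op : Monoid.law e) (n p w : nat),
  1 <= p <= n -> C * (trunc_log 2 n).+1 <= w ->
  forall A : 'I_n -> T,
  exists (t : nat) (final : config n (c * p) k T),
    [/\ run w e op prog t (initial (c * p) k A) = Some final,
        all_halted prog final,
        forall i : 'I_n, shared final i = EltW (prefix_value op A i),
        work final <= C * n
      & span final <= C * (n %/ p + trunc_log 2 p)].
Proof.
exists 14, scan_prog, 1, 500 => T e op n p w /andP[p_gt0 le_pn] le_w A; rewrite mul1n.
apply: scan_spec => //.
have lt_n := trunc_log_ltn n (isT : 1 < 2).
have : 2 ^ (500 * (trunc_log 2 n).+1) <= 2 ^ w by rewrite leq_exp2l.
apply: leq_trans; apply: leq_trans (_ : 2 ^ (4 * (trunc_log 2 n).+1) <= _); last first.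
  by rewrite leq_exp2l // leq_mul2r orbT.
(* Both [n.+1] and 2 are at most [2 ^ x], so [4 * (n.+1 * n.+1)] is a product of four factors
   bounded by [2 ^ x]. *)
set x := (trunc_log 2 n).+1 in lt_n *.
have -> : 4 * x = x + x + (x + x) by lia.
have le2 : 2 <= 2 ^ x by apply: (@leq_pexp2l 2 1 x).
by rewrite !expnD !leq_mul //; apply: (@leq_mul 2 2).
Qed.
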